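(* Let $X$ be a metrizable space. Then $X$ is finite-dimensional and compact if and only if the set of all doubling metrics in $\mathrm{Met}(X)$ is a dense $F_{\sigma}$ subset of $(\mathrm{Met}(X), \mathcal{D}_X)$.
   Context: For a metrizable space $X$, $\mathrm{Met}(X)$ denotes the set of all metrics on $X$ generating the given topology of $X$. The function $\mathcal{D}_X:\mathrm{Met}(X)^2\to[0,\infty]$ is $\mathcal{D}_X(d,e)=\sup_{x,y\in X}|d(x,y)-e(x,y)|$; it is a (possibly $\infty$-valued) metric on $\mathrm{Met}(X)$, and $\mathrm{Met}(X)$ carries the topology it induces. ''Finite-dimensional'' means finite covering dimension. For a metric space $(X,d)$ and $A\subseteq X$, $\delta_d(A)$ is the diameter of $A$ and $\alpha_d(A)=\inf\{d(x,y): x\neq y,\ x,y\in A\}$. A metric space $(X,d)$ is doubling if there exist $\beta\in(0,\infty)$ and $C\in[1,\infty)$ such that every finite subset $A\subseteq X$ with at least two points satisfies $\mathrm{card}(A)\le C(\delta_d(A)/\alpha_d(A))^{\beta}$. A subset is $F_\sigma$ if it is a countable union of closed sets. *)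

(* Defs.v *)
From mathcomp Require Import all_boot all_order all_algebra.
From mathcomp Require Import all_classical all_reals all_analysis.
From mathcomp Require Import finmap.
Unset Printing Implicit Defensive.
Import Order.TTheory GRing.Theory Num.Theory.
Local Open Scope classical_set_scope.
Local Open Scope ring_scope.

Section Defs.
Variable R : realType.

Definition covdim_le (X : topologicalType) (n : nat) : Prop :=
  forall (k : nat) (U : 'I_k -> set X),
    (forall i, open (U i)) -> \bigcup_i U i = [set: X] ->
    exists (m : nat) (V : 'I_m -> set X),
      [/\ (forall j, open (V j)),
          \bigcup_j V j = [set: X],
          (forall j, exists i, V j `<=` U i) &
          (forall x, (#|[set j : 'I_m | `[< V j x >]]| <= n.+1)%N)].

Definition finite_dimensional (X : topologicalType) : Prop :=
  exists n : nat, covdim_le X n.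

Definition is_metric (X : Type) (d : X -> X -> R) : Prop :=
  [/\ (forall x y, 0 <= d x y),
      (forall x y, d x y = 0 <-> x = y),
      (forall x y, d x y = d y x) &
      (forall x y z, d x z <= d x y + d y z)].

Definition generates_topology (X : topologicalType) (d : X -> X -> R) : Prop :=
  forall U : set X,
    open U <-> (forall x, U x -> exists2 r : R, 0 < r & [set y | d x y < r] `<=` U).

Definition Met (X : topologicalType) : set (X -> X -> R) :=
  [set d | is_metric X d /\ generates_topology X d].

Definition metrizable (X : topologicalType) : Prop := exists d, Met X d.

Definition DX (X : topologicalType) (d e : X -> X -> R) : \bar R :=
  ereal_sup [set z | exists x y, z = (`|d x y - e x y|)%:E].

Definition Dball (X : topologicalType) (d : X -> X -> R) (eps : R) :=
  [set e | Met X e /\ (DX X d e < eps%:E)%E].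

Definition Met_open (X : topologicalType) (A : set (X -> X -> R)) : Prop :=
  A `<=` Met X /\
  forall d, A d -> exists2 eps : R, 0 < eps & Dball X d eps `<=` A.

Definition Met_closed (X : topologicalType) (A : set (X -> X -> R)) : Prop :=
  A `<=` Met X /\ Met_open X (Met X `\` A).

Definition Met_Fsigma (X : topologicalType) (A : set (X -> X -> R)) : Prop :=
  exists F : nat -> set (X -> X -> R),
    (forall n, Met_closed X (F n)) /\ A = \bigcup_n F n.

Definition Met_dense (X : topologicalType) (A : set (X -> X -> R)) : Prop :=
  A `<=` Met X /\
  forall U, Met_open X U -> U !=set0 -> (U `&` A) !=set0.

Definition diam (X : Type) (d : X -> X -> R) (A : set X) : R :=
  sup [set r | exists x y, [/\ A x, A y & r = d x y]].

Definition sepr (X : Type) (d : X -> X -> R) (A : set X) : R :=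
  inf [set r | exists x y, [/\ A x, A y, x <> y & r = d x y]].

Definition doubling (X : choiceType) (d : X -> X -> R) : Prop :=
  exists (beta C : R), [/\ 0 < beta, 1 <= C &
    forall A : set X, finite_set A -> (2 <= (#|` fset_set A|)%fset)%N ->
      (#|` fset_set A|)%fset%:R <= C * powR (diam X d A / sepr X d A) beta].

Definition DoublingMet (X : topologicalType) : set (X -> X -> R) :=
  [set d | Met X d /\ doubling X d].

End Defs.

(* Main.v *)
Require Import Defs.
From mathcomp Require Import all_boot all_order all_algebra.
From mathcomp Require Import all_classical all_reals all_analysis.
From mathcomp Require Import finmap ring lra.

(** Density forces compactness: a noncompact [X] carries a compatible metric for
    which some infinite set has all mutual distances [1], and no metric
    uniformly close to it is doubling.  A doubling metric on a compact space
    bounds the multiplicity of covers by balls centred at separated nets, hence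
    the covering dimension.

    Conversely, the sets of metrics with [card A <= N (diam A / sep A)^N] are
    closed for each [N].  For density, the distances to a finite net approximate
    [d] by a sup-metric pulled back from some [R^k]; it remains to add finitely
    many small continuous functions that separate points, since any metric
    pulled back from [R^N] is doubling.  These functions are a limit of
    perturbations in the manner of Kolmogorov: for a fine cover of order
    [n + 1] with depth functions [phi_j], and for a threshold [theta], the
    nonempty sets [{j | phi_j x > theta}] classify the points [x] into small
    pieces, which are well separated away from the points where some [phi_j]
    equals [theta].  As at most [n + 1] thresholds are bad at a given point,
    among [2 n + 3] thresholds one is good for any two given points. *)

Set Implicit Arguments.
Unset Strict Implicit.
Unset Printing Implicit Defensive.
Import Order.TTheory GRing.Theory Num.Theory.
Import numFieldNormedType.Exports.
Local Open Scope classical_set_scope.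
Local Open Scope ring_scope.

Lemma seq_pos_lbound (R : realType) (T : eqType) (s : seq T) (r : T -> R) :
  (forall x, 0 < r x) -> exists2 l : R, 0 < l & forall x, x \in s -> l <= r x.
Proof.
move=> r0; exists (\big[Order.min/1]_(x <- s) r x).
  by apply: lt_bigmin => // i _; exact: r0.
by move=> x xs; apply: ge_bigmin_seq.
Qed.

(** * Metrics and compactness *)

Section Metric.
Variables (R : realType) (X : topologicalType) (d : X -> X -> R).
Hypothesis Md : Met R X d.

Lemma Met_ge0 x y : 0 <= d x y. Proof. by case: Md => -[]. Qed.
Lemma Met_sym x y : d x y = d y x. Proof. by case: Md => -[]. Qed.
Lemma Met_triangle x y z : d x z <= d x y + d y z.
Proof. by case: Md => -[]. Qed.
Lemma Met_refl x : d x x = 0.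
Proof. by case: Md => -[_ h _ _] _; apply/h. Qed.
Lemma Met_gt0 x y : x <> y -> 0 < d x y.
Proof.
move=> xy; rewrite lt_neqAle Met_ge0 andbT eq_sym; apply/eqP.
by case: Md => -[_ h _ _] _ /h.
Qed.

Lemma Met_ball_open x r : open [set y | d x y < r].
Proof.
case: Md => _ /(_ [set y | d x y < r]) ->.
move=> y /= xy; exists (r - d x y); first by rewrite subr_gt0.
move=> z /= yz; have := Met_triangle x y z; lra.
Qed.

Lemma Met_nbhsP x (A : set X) :
  nbhs x A <-> exists2 r, 0 < r & [set y | d x y < r] `<=` A.
Proof.
split.
  rewrite nbhsE => -[B [oB Bx] BA]; case: Md => _ /(_ B) [/(_ oB) /(_ _ Bx)].
  by case=> r r0 rB _; exists r => //; exact: subset_trans BA.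
case=> r r0 /filterS; apply; apply: open_nbhs_nbhs; split.
  exact: Met_ball_open.
by rewrite /= Met_refl.
Qed.

Lemma Met_near x r : 0 < r -> \forall y \near x, d x y < r.
Proof. by move=> r0; apply/Met_nbhsP; exists r. Qed.

Lemma Met_dist_lip x y z : `|d x z - d y z| <= d x y.
Proof.
have := Met_triangle x y z; have := Met_triangle y x z; rewrite (Met_sym y x).
rewrite ler_distl; lra.
Qed.

Lemma Met_lip_continuous (L : R) (f : X -> R) : 0 < L ->
  (forall x y, `|f x - f y| <= L * d x y) -> continuous f.
Proof.
move=> L0 fl x; apply/cvgrPdist_lt => e e0; near=> y.
apply: le_lt_trans (fl x y) _; rewrite mulrC -ltr_pdivlMr//.
by near: y; apply: Met_near; exact: divr_gt0.
Unshelve. all: by end_near. Qed.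

(* Balls with a prescribed radius at each centre: otherwise the complements of
   the finite unions of such balls generate a filter without cluster point. *)
Lemma compact_gauge (r : X -> R) : compact [set: X] -> (forall x, 0 < r x) ->
  exists s : seq X, forall y, exists2 x, x \in s & d x y < r x.
Proof.
move=> cX r0; apply: contrapT => /forallNP ns.
pose B (s : seq X) := [set y | forall x, x \in s -> r x <= d x y].
pose F : set_system X := [set A | exists s, B s `<=` A].
have FF : ProperFilter F.
  apply: Build_ProperFilter.
    case=> s sB; apply: (ns s) => y; apply: contrapT => h.
    apply: (sB y) => x xs; rewrite leNgt; apply/negP => xy.
    by apply: h; exists x.
  split.
  - by exists [::].
  - move=> P Q [s sP] [t tQ]; exists (s ++ t) => y By.
    by split; [apply: sP|apply: tQ] => x xs; apply: By; rewrite mem_cat xs ?orbT.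
  - by move=> P Q PQ [s sP]; exists s; exact: subset_trans PQ.
have [p [_ clp]] := cX F FF (@filterT _ F _).
have Fp : F (B [:: p]) by exists [:: p].
have [y [/= Bpy py]] := clp _ _ Fp (@Met_near p (r p) (r0 p)).
by move: (Bpy p (mem_head _ _)); rewrite leNgt py.
Qed.

(** Around each point some ball of twice the chosen radius lies in one [U i]. Finitely many of the
    undoubled balls cover, and the smallest of their radii fits into the spare half. *)
Lemma lebesgue_number (I : Type) (U : I -> set X) : compact [set: X] ->
  (forall i, open (U i)) -> \bigcup_i U i = [set: X] ->
  exists2 l : R, 0 < l &
    forall y, exists i, [set z | d y z < l] `<=` U i.
Proof.
move=> cX oU cU.
have /choice[r rP] : forall x, exists r : R, 0 < r /\
    exists i, [set z | d x z < r + r] `<=` U i.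
  move=> x; have : (\bigcup_i U i) x by rewrite cU.
  case=> i _ Uix; have /Met_nbhsP[r r0 rU] : nbhs x (U i).
    by apply: open_nbhs_nbhs.
  by exists (r / 2); split; [lra | exists i; rewrite -splitr].
have [s sP] := compact_gauge cX (fun x => (rP x).1).
have [l l0 ls] := seq_pos_lbound s (fun x => (rP x).1).
exists l => // y; have [x xs xy] := sP y; have [i Ui] := (rP x).2.
exists i => z /= yz; apply: Ui => /=; have := ls x xs.
have := Met_triangle x y z; lra.
Qed.

End Metric.

(** * Diameter and separation of finite sets *)

Section DiamSepr.
Variables (R : realType) (X : topologicalType) (d : X -> X -> R).
Hypothesis Md : Met R X d.

Lemma card_fset_setP (A : set X) : finite_set A ->
  exists s : seq X, [/\ uniq s, size s = (#|` fset_set A|)%fset &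
    forall x, (x \in s) <-> A x].
Proof.
move=> fA; exists (fset_set A); split => //; first exact: fset_uniq.
by move=> x; rewrite in_fset_set //; split => [/set_mem|/mem_set].
Qed.

Lemma two_points (s : seq X) : uniq s -> (2 <= size s)%N ->
  exists x y, [/\ x \in s, y \in s & x <> y].
Proof.
case: s => [|x [|y s]] //= /and3P[xy _ _] _; exists x, y; split.
- by rewrite inE eqxx.
- by rewrite !inE eqxx orbT.
- by move=> e; move: xy; rewrite e inE eqxx.
Qed.

Lemma le_diam (A : set X) x y : finite_set A -> A x -> A y ->
  d x y <= diam R X d A.
Proof.
move=> /card_fset_setP[s [_ _ sA]] Ax Ay; apply: ub_le_sup; last by exists x, y.
exists (\big[Order.max/0]_(p <- [seq (u, v) | u <- s, v <- s]) d p.1 p.2).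
move=> _ [u [v [/sA us /sA vs ->]]].
by apply: (le_bigmax_seq _ (u, v)) => //; rewrite allpairs_f.
Qed.

Lemma diam_le (A : set X) r : A !=set0 ->
  (forall x y, A x -> A y -> d x y <= r) -> diam R X d A <= r.
Proof.
move=> [a Aa] h; apply: ge_sup; first by exists (d a a), a, a.
by move=> _ [x [y [Ax Ay ->]]]; exact: h.
Qed.

Lemma sepr_le (A : set X) x y : A x -> A y -> x <> y -> sepr R X d A <= d x y.
Proof.
move=> Ax Ay xy; apply: ge_inf; last by exists x, y.
by exists 0 => _ [u [v [_ _ _ ->]]]; exact: Met_ge0.
Qed.

Lemma le_sepr (A : set X) r : (exists x y, [/\ A x, A y & x <> y]) ->
  (forall x y, A x -> A y -> x <> y -> r <= d x y) -> r <= sepr R X d A.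
Proof.
move=> [a [b [Aa Ab ab]]] h; apply: lb_le_inf; first by exists (d a b), a, b.
by move=> _ [x [y [Ax Ay xy ->]]]; exact: h.
Qed.

Lemma sepr_gt0 (A : set X) : finite_set A ->
  (exists x y, [/\ A x, A y & x <> y]) -> 0 < sepr R X d A.
Proof.
move=> /card_fset_setP[s [_ _ sA]] A2.
(* The value [1] on the diagonal makes all pairs positive and leaves distinct pairs unchanged. *)
pose r (p : X * X) : R := if p.1 == p.2 then 1 else d p.1 p.2.
have r0 p : 0 < r p.
  by rewrite /r; case: eqP => // /(Met_gt0 Md).
have [l l0 ls] := seq_pos_lbound [seq (u, v) | u <- s, v <- s] r0.
apply: (lt_le_trans l0); apply: le_sepr => // x y /sA xs /sA ys xy.
have := ls (x, y); rewrite allpairs_f // => /(_ isT).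
by rewrite /r /=; case: eqP.
Qed.

Lemma diam_sepr_ge1 (A : set X) : finite_set A ->
  (exists x y, [/\ A x, A y & x <> y]) -> 1 <= diam R X d A / sepr R X d A.
Proof.
move=> fA A2; rewrite ler_pdivlMr ?sepr_gt0// mul1r.
have [x [y [Ax Ay xy]]] := A2.
exact: le_trans (sepr_le Ax Ay xy) (le_diam fA Ax Ay).
Qed.

(** Form in which doubling is applied: bounds [D] and [a] replace the exact diameter and separation,
    since [powR] with a positive exponent is monotone. *)
Lemma doubling_card (beta C : R) (s : seq X) (a D : R) : 0 < beta -> 1 <= C ->
  (forall A : set X, finite_set A -> (2 <= (#|` fset_set A|)%fset)%N ->
    (#|` fset_set A|)%fset%:R <= C * powR (diam R X d A / sepr R X d A) beta) ->
  uniq s -> 0 < a ->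
  (forall x y, x \in s -> y \in s -> d x y <= D) ->
  (forall x y, x \in s -> y \in s -> x <> y -> a <= d x y) ->
  (2 <= size s)%N ->
  (size s)%:R <= C * powR (D / a) beta.
Proof.
move=> b0 C1 dbl us a0 sD sa s2; have [x [y [xs ys xy]]] := two_points us s2.
have fA : finite_set [set` s] by exact: finite_seq.
have cA : (#|` fset_set [set` s]|)%fset = size s.
  have [t [ut <- tA]] := card_fset_setP fA.
  apply: perm_size; apply: uniq_perm => // z.
  by apply/idP/idP => /tA.
have A2 : exists x y, [/\ [set` s] x, [set` s] y & x <> y] by exists x, y.
have := dbl _ fA; rewrite cA => /(_ s2) /le_trans; apply.
rewrite ler_pM2l; last by lra.
apply: ge0_ler_powR; [exact: ltW| | |].
- by rewrite nnegrE (le_trans ler01)// diam_sepr_ge1.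
- rewrite nnegrE; apply: divr_ge0; last exact: ltW.
  by apply: le_trans (sD x y xs ys); exact: Met_ge0.
- apply: ler_pM.
  + by apply: le_trans (le_diam fA xs ys); exact: Met_ge0.
  + by rewrite invr_ge0 ltW// sepr_gt0.
  + by apply: diam_le; [exists x|exact: sD].
  + by rewrite lef_pV2 ?posrE ?sepr_gt0//; exact: le_sepr.
Qed.

End DiamSepr.

(** * Doubling metrics *)

(** Bridge between the classical comprehension counted in [covdim_le] and finite sets. *)
Lemma card_mkset (T : finType) (P : pred T) : #|[set j | P j]| = #|finset P|.
Proof.
by apply: eq_card => j; rewrite finset.inE; apply/idP/idP => [/set_mem|/mem_set].
Qed.

(** Greedy choice along the list: a point is kept only when no point kept so far is closer than
    [r]. *)
Lemma separated_subnet (R : realType) (X : topologicalType) (d : X -> X -> R)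
    (r : R) (s : seq X) : Met R X d -> 0 < r ->
  exists t : seq X, [/\ uniq t,
    (forall x y, x \in t -> y \in t -> x <> y -> r <= d x y) &
    (forall x, x \in s -> exists2 y, y \in t & d y x < r)].
Proof.
move=> Md r0; elim: s => [|a s [t [ut tr ts]]]; first by exists [::].
have [[y yt ya]|na] := pselect (exists2 y, y \in t & d y a < r).
  exists t; split => // x; rewrite inE => /orP[/eqP->|/ts//].
  by exists y.
have far y : y \in t -> r <= d y a.
  by move=> yt; rewrite leNgt; apply/negP => ya; apply: na; exists y.
exists (a :: t); split.
- rewrite /= ut andbT; apply/negP => /far.
  by rewrite (Met_refl Md) leNgt r0.
- move=> x y; rewrite !inE => /orP[/eqP->|xt] /orP[/eqP->|yt] xy //.
  + by rewrite (Met_sym Md); exact: far.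
  + exact: far.
  + exact: tr.
- move=> x; rewrite inE => /orP[/eqP->|/ts[y yt yx]].
    by exists a; rewrite ?mem_head// (Met_refl Md).
  by exists y => //; rewrite inE yt orbT.
Qed.

(** Balls of radius [l] about an [l / 2]-separated net refine the cover. Centres of balls through
    one point are less than [2 l] apart, so the ratio is at most [4] and there are at most
    [C * 4 ^ beta] of them. *)
Lemma doubling_compact_finite_dimensional (R : realType) (X : topologicalType)
    (d : X -> X -> R) :
  Met R X d -> doubling R X d -> compact [set: X] -> finite_dimensional X.
Proof.
move=> Md [beta [C [b0 C1 dbl]]] cX.
pose N := Num.truncn (C * powR 4 beta).
exists N => k U oU cU; have [l l0 lU] := lebesgue_number Md cX oU cU.
have r0 : 0 < l / 2 by lra.
have [s sP] := compact_gauge Md cX (fun=> r0).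
have [t [ut tr ts]] := separated_subnet s Md r0.
exists (size t), (fun j => [set y | d (tnth (in_tuple t) j) y < l]); split.
- by move=> j; exact: Met_ball_open.
- apply/seteqP; split => // y _; have [x xs xy] := sP y.
  have [z zt zx] := ts x xs.
  have /tnthP[j zj] : z \in in_tuple t by [].
  exists j => //=; rewrite -zj; have := Met_triangle Md z x y; lra.
- by move=> j; exact: lU.
- move=> x; rewrite card_mkset.
  set J := finset _.
  (* Doubling says nothing about sets with fewer than two points. *)
  have [J1|J2] := leqP #|J| 1; first exact: leq_trans J1 _.
  pose s' := [seq tnth (in_tuple t) j | j <- enum J].
  have tinj : injective (tnth (in_tuple t)) by apply/tuple_uniqP.
  have s'P y : y \in s' -> y \in t /\ d y x < l.
    case/mapP => j; rewrite mem_enum inE => /asboolP jx ->; split => //.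
    exact: mem_tnth.
  have ss' : size s' = #|J| by rewrite size_map -cardE.
  rewrite -ss' -(ler_nat R). apply: ltW.
  apply: (@le_lt_trans _ _ (C * powR 4 beta)); last exact: truncnS_gt.
  have -> : 4 = (l + l) / (l / 2) by field; rewrite gt_eqF.
  apply: (doubling_card Md) => //.
  + by rewrite map_inj_uniq ?enum_uniq.
  + move=> y z /s'P[_ yx] /s'P[_ zx].
    have := Met_triangle Md y x z; rewrite (Met_sym Md x z); lra.
  + by move=> y z /s'P[yt _] /s'P[zt _]; exact: tr.
  + by rewrite ss'.
Qed.

(** * The doubling metrics as an F-sigma set *)

Lemma DX_ltP (R : realType) (X : topologicalType) (d e : X -> X -> R) eps x y :
  (DX R X d e < eps%:E)%E -> `|d x y - e x y| < eps.
Proof.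
rewrite -lte_fin; apply: le_lt_trans; apply: ereal_sup_ubound.
by exists x, y.
Qed.

Lemma DX_le (R : realType) (X : topologicalType) (d e : X -> X -> R) eps :
  (forall x y, `|d x y - e x y| <= eps) -> (DX R X d e <= eps%:E)%E.
Proof. by move=> h; apply: ge_ereal_sup => _ [x [y ->]]; rewrite lee_fin. Qed.

(** One integer serves as constant and exponent, which writes the doubling metrics as a countable
    union. *)
Definition doubling_at (R : realType) (X : topologicalType) (n : nat)
    (d : X -> X -> R) :=
  forall A : set X, finite_set A -> (2 <= (#|` fset_set A|)%fset)%N ->
    (#|` fset_set A|)%fset%:R <=
    n.+1%:R * (diam R X d A / sepr R X d A) ^+ n.+1 :> R.

Lemma fset_set_two (X : topologicalType) (A : set X) : finite_set A ->
  (2 <= (#|` fset_set A|)%fset)%N -> exists x y, [/\ A x, A y & x <> y].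
Proof.
move=> fA; have [s [us <- sA]] := card_fset_setP fA => /(two_points us).
by case=> x [y [/sA xA /sA yA xy]]; exists x, y.
Qed.

(** The ratio is at least [1] on sets with two points, so constant and exponent may both be raised
    to a common integer. *)
Lemma doublingP (R : realType) (X : topologicalType) (d : X -> X -> R) :
  Met R X d -> doubling R X d <-> exists n, doubling_at n d.
Proof.
move=> Md; split.
  case=> beta [C [b0 C1 dbl]].
  pose n := (Num.truncn beta + Num.truncn C)%N.
  have bn : beta <= n.+1%:R.
    apply: ltW; apply: lt_le_trans (truncnS_gt _) _.
    by rewrite ler_nat ltnS leq_addr.
  have Cn : C <= n.+1%:R.
    apply: ltW; apply: lt_le_trans (truncnS_gt _) _.
    by rewrite ler_nat ltnS leq_addl.
  exists n => A fA A2; apply: le_trans (dbl A fA A2) _.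
  have t1 := diam_sepr_ge1 Md fA (fset_set_two fA A2).
  rewrite -powR_mulrn; last by lra.
  apply: ler_pM => //; [lra|exact: powR_ge0|exact: ler_powR].
case=> n dn; exists n.+1%:R, n.+1%:R; split => //; first by rewrite ler1n.
move=> A fA A2; rewrite powR_mulrn; first exact: dn.
have := diam_sepr_ge1 Md fA (fset_set_two fA A2); lra.
Qed.

(** The complement is open: the inequality fails strictly at one finite set [A], and a metric within
    [eps] of [d] raises the diameter of [A] and lowers its separation by at most [eps]. *)
Lemma doubling_at_closed (R : realType) (X : topologicalType) n :
  Met_closed R X (Met R X `&` doubling_at n).
Proof.
split; first by move=> d [].
split; first by move=> d [].
move=> d [Md] /not_andP[//|]; rewrite /doubling_at.
move/existsNP=> [A /not_implyP[fA /not_implyP[A2 /negP]]]; rewrite -ltNge.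
set c := (#|` fset_set A|)%:R; set D := diam _ _ _ _; set a := sepr _ _ _ _ => lt_c.
have AA := fset_set_two fA A2.
have a0 : 0 < a by exact: sepr_gt0.
have t1 := diam_sepr_ge1 Md fA AA; rewrite -/D -/a in t1.
have [t' tt' t'c] : exists2 t', D / a < t' & n.+1%:R * t' ^+ n.+1 < c.
  have : {for D / a, continuous (fun t : R => n.+1%:R * t ^+ n.+1)}.
    by apply: cvgM; [exact: cvg_cst|exact: exprn_continuous].
  move=> /cvgrPdist_lt /(_ (c - n.+1%:R * (D / a) ^+ n.+1)).
  rewrite subr_gt0 => /(_ lt_c) /nbhs_ballP[r /= r0 rP].
  exists (D / a + r / 2); first by lra.
  have := rP (D / a + r / 2); rewrite /ball /= opprD addrA subrr add0r normrN.
  rewrite gtr0_norm; last by lra.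
  have -> : r / 2 < r by lra.
  by move=> /(_ isT); rewrite ltr_distl; lra.
(* Solves [(D + eps) / (a - eps) = t'], a ratio at which the bound still fails. *)
pose eps := (t' * a - D) / (1 + t').
have eps0 : 0 < eps.
  apply: divr_gt0; last by lra.
  by rewrite subr_gt0 -ltr_pdivrMr.
have epsE : D + eps = t' * (a - eps).
  have : eps * (1 + t') = t' * a - D by rewrite /eps mulfVK//; lra.
  lra.
have D0 : a <= D by rewrite ler_pdivlMr ?mul1r in t1.
have aeps : 0 < a - eps.
  have t'0 : 0 < t' by lra.
  by rewrite -(pmulr_rgt0 _ t'0) -epsE; lra.
exists eps => // e [Me de]; split => // -[_ /(_ A fA A2)].
apply/negP; rewrite -ltNge; apply: le_lt_trans t'c; rewrite ler_pM2l ?ltr0n//.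
have t1' := diam_sepr_ge1 Me fA AA.
apply: lerXn2r; rewrite ?nnegrE; [lra|lra|].
have ea : a - eps <= sepr R X e A.
  apply: le_sepr => // x y Ax Ay xy.
  have := sepr_le Md Ax Ay xy; have := DX_ltP x y de.
  by rewrite -/a ltr_distl; lra.
rewrite ler_pdivrMr ?sepr_gt0//; apply: (@le_trans _ _ (t' * (a - eps))).
  rewrite -epsE; apply: diam_le; first by case: AA => x [y [Ax _ _]]; exists x.
  move=> x y Ax Ay; have := le_diam d fA Ax Ay; have := DX_ltP x y de.
  by rewrite -/D ltr_distl; lra.
by rewrite ler_pM2l//; lra.
Qed.

Lemma DoublingMet_Fsigma (R : realType) (X : topologicalType) :
  Met_Fsigma R X (DoublingMet R X).
Proof.
exists (fun n => Met R X `&` doubling_at n); split.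
  by move=> n; exact: doubling_at_closed.
apply/seteqP; split => d.
  by move=> [Md /(doublingP Md)[n dn]]; exists n.
by move=> [n _ [Md dn]]; split => //; apply/doublingP => //; exists n.
Qed.

(** * Noncompact spaces *)

Lemma Met_equiv (R : realType) (X : topologicalType) (d e : X -> X -> R) :
  Met R X d -> is_metric R X e ->
  (forall x r, 0 < r -> exists2 t, 0 < t & forall y, d x y < t -> e x y < r) ->
  (forall x r, 0 < r -> exists2 t, 0 < t & forall y, e x y < t -> d x y < r) ->
  Met R X e.
Proof.
move=> Md ie de ed; split => // U; case: Md => _ ->; split=> h x Ux.
  have [r r0 rU] := h x Ux; have [t t0 tP] := ed x r r0.
  by exists t => // y /= /tP /rU.
have [r r0 rU] := h x Ux; have [t t0 tP] := de x r r0.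
by exists t => // y /= /tP /rU.
Qed.

(* Each new term avoids balls around the previous ones whose radii are nearly
   as large as possible among balls negligible for a filter without cluster
   point; a point where the sequence accumulates would force such a radius to
   be too small. *)
Lemma noncompact_discrete_sequence (R : realType) (X : topologicalType)
    (d : X -> X -> R) : Met R X d -> ~ compact [set: X] ->
  exists u : nat -> X, forall p, exists2 t, 0 < t &
    forall m n, d p (u m) < t -> d p (u n) < t -> m = n.
Proof.
move=> Md /existsNP[F /not_implyP[FF /not_implyP[_ ncl]]].
pose small x r := F (~` [set y | d x y < r]).
have sm x : exists2 r, 0 < r & small x r.
  have : ~ cluster F x by move=> clx; apply: ncl; exists x.
  move/existsNP=> [A /existsNP[B /not_implyP[FA /not_implyP[xB AB]]]].
  have [r r0 rB] := (Met_nbhsP Md x B).1 xB.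
  exists r => //; apply: filterS FA => y Ay /= /rB By.
  by apply: AB; exists y.
have smS x y r t : d x y + t <= r -> small x r -> small y t.
  move=> h; apply: filterS => z /= nz yz; apply: nz.
  have := Met_triangle Md x y z; lra.
have /choice[rho rhoP] : forall x, exists r, [/\ 0 < r, small x r &
    forall t, t <= 1 -> small x t -> t <= r + r].
  (* The cap [1] keeps the set of radii bounded; [rho x] then exceeds half of its supremum. *)
  move=> x; pose E := [set r : R | r <= 1 /\ small x r].
  have [r0 r00 sr0] := sm x.
  pose r1 := Num.min r0 1.
  have Er1 : E r1.
    split; first by rewrite ge_min lexx orbT.
    by apply: smS sr0; rewrite (Met_refl Md) add0r ge_min lexx.
  have supE : has_sup E by split; [exists r1|exists 1 => r []].
  have r1s : r1 <= sup E by apply: ub_le_sup => //; case: supE.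
  have r10 : 0 < r1 by rewrite lt_min r00 ltr01.
  have s0 : 0 < sup E / 2 by lra.
  have [r [r_1 sr] rs] := sup_adherent s0 supE.
  exists r; split => //; first by lra.
  move=> t t1 st; have : t <= sup E by apply: ub_le_sup => //; case: supE.
  lra.
have /choice[nx nxP] : forall s : seq X, exists y, forall x, x \in s ->
    rho x <= d x y.
  move=> s; suff : F [set y | forall x, x \in s -> rho x <= d x y].
    by move/filter_ex.
  elim: s => [|a s IH]; first by apply: filterS filterT.
  have [_ sa _] := rhoP a.
  apply: filterS2 IH sa => y ys /= ya x; rewrite inE => /orP[/eqP->|/ys//].
  by rewrite leNgt; apply/negP.
pose S n := iter n (fun s => nx s :: s) [::].
pose u n := nx (S n).
have uS m n : (m < n)%N -> u m \in S n.
  elim: n => // n IH; rewrite ltnS leq_eqVlt => /orP[/eqP->|/IH].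
    by rewrite /S iterS mem_head.
  by rewrite {2}/S iterS inE => ->; rewrite orbT.
exists u => p; have [r r0 sr] := sm p.
pose ep := Num.min r 1 / 2.
have m0 : 0 < Num.min r 1 by rewrite lt_min r0 ltr01.
have mr : Num.min r 1 <= r by rewrite ge_min lexx.
have m1 : Num.min r 1 <= 1 by rewrite ge_min lexx orbT.
(* If both terms are within [ep / 4] of [p], the ball of radius [ep] at [u m] is still negligible,
   so [rho (u m)] is at least [ep / 2], while [d (u m) (u n)] is less. *)
have key m n : d p (u m) < ep / 4 -> d p (u n) < ep / 4 -> ~ (m < n)%N.
  move=> pm pn mn; have [_ _ /(_ ep)] := rhoP (u m).
  have -> : ep <= 1 by rewrite /ep; lra.
  move=> /(_ isT); have smu : small (u m) ep.
    by apply: smS sr; move: pm; rewrite /ep; lra.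
  move=> /(_ smu); have := nxP _ _ (uS m n mn); rewrite -/(u n).
  have := Met_triangle Md (u m) p (u n); rewrite (Met_sym Md (u m) p).
  by move: pm pn; rewrite /ep; lra.
exists (ep / 4); first by rewrite /ep; lra.
move=> m n pm pn; case: (ltngtP m n) => // [/key|/key].
  by move=> /(_ pm pn).
by move=> /(_ pn pm).
Qed.

(** Tents [f n] of height [1] at [u n], zero at all other terms, are joined to the truncated metric
    through the supremum of their differences. Their supports are locally finite, so the topology is
    unchanged. *)
Lemma noncompact_equilateral_metric (R : realType) (X : topologicalType)
    (d : X -> X -> R) : Met R X d -> ~ compact [set: X] ->
  exists (e : X -> X -> R) (u : nat -> X), Met R X e /\
    forall m n, m <> n -> e (u m) (u n) = 1.
Proof.
move=> Md ncX; have [u uP] := noncompact_discrete_sequence Md ncX.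
have /choice[tau tauP] : forall n, exists t, 0 < t /\
    forall m, d (u n) (u m) < t -> m = n.
  move=> n; have [t t0 tP] := uP (u n); exists t; split => // m umn.
  by apply: tP => //; rewrite (Met_refl Md).
(* [tau n] keeps the other terms out of the support; [1 / (n + 1)] shrinks the supports, so that
   only finitely many come near a given point. *)
pose r n := Num.min (tau n) n.+1%:R^-1.
have r0 n : 0 < r n by rewrite lt_min (tauP n).1 invr_gt0 ltr0n.
pose f n x := Num.max 0 (1 - d (u n) x / r n).
have f0 n x : 0 <= f n x by rewrite /f le_max lexx.
have f1 n x : f n x <= 1.
  have : 0 <= d (u n) x / r n by rewrite divr_ge0 ?(Met_ge0 Md)// ltW.
  by rewrite /f ge_max ler01 /=; lra.
have flip n x y : `|f n x - f n y| <= d x y / r n.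
  have dxy : 0 <= d x y / r n by rewrite divr_ge0 ?(Met_ge0 Md)// ltW.
  have h a b : d (u n) b / r n <= d (u n) a / r n + d a b / r n.
    rewrite -mulrDl ler_pM2r ?invr_gt0//; exact: Met_triangle.
  have := h x y; have := h y x; rewrite (Met_sym Md y x) ler_distl /f.
  move: (d (u n) x / r n) (d (u n) y / r n) (d x y / r n) dxy => a b c *.
  by rewrite /Num.max; do 2 case: ifP => ?; lra.
have f_far n x : r n <= d (u n) x -> f n x = 0.
  move=> rd; apply/max_idPl; rewrite subr_le0 ler_pdivlMr// mul1r//.
pose h x y := sup (range (fun n => `|f n x - f n y|)).
have hle x y c : (forall n, `|f n x - f n y| <= c) -> h x y <= c.
  move=> hc; apply: ge_sup; first by exists `|f 0%N x - f 0%N y|, 0%N.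
  by move=> _ [n _ <-]; exact: hc.
have leh x y n : `|f n x - f n y| <= h x y.
  apply: ub_le_sup; last by exists n.
  exists 1 => _ [k _ <-]; rewrite ler_distl.
  have := f0 k x; have := f1 k x; have := f0 k y; have := f1 k y; lra.
have h0 x y : 0 <= h x y by apply: le_trans (leh x y 0%N).
pose e x y := Num.max (Num.min (d x y) 1) (h x y).
have ee x y c : (e x y <= c) = (Num.min (d x y) 1 <= c) && (h x y <= c).
  by rewrite ge_max.
have eh x y : h x y <= e x y by rewrite le_max lexx orbT.
have em x y : Num.min (d x y) 1 <= e x y by rewrite le_max lexx.
exists e, u; split.
  apply: (Met_equiv Md).
  - split.
    + by move=> x y; apply: le_trans (h0 x y) (eh x y).
    + move=> x y; split=> [exy|<-].
        apply: contrapT => /(Met_gt0 Md) dxy; have := em x y.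
        by rewrite exy leNgt lt_min dxy ltr01.
      apply/eqP; rewrite eq_le (le_trans (h0 x x) (eh x x)) andbT ee.
      rewrite (Met_refl Md) ge_min lexx /=; apply: hle => n.
      by rewrite subrr normr0.
    + move=> x y; rewrite /e (Met_sym Md); congr Num.max; congr sup.
      by apply/seteqP; split=> _ [n _ <-]; exists n; rewrite // distrC.
    + move=> x y z; rewrite ee; apply/andP; split.
        apply: le_trans (lerD (em x y) (em y z)).
        have := Met_triangle Md x y z; have := Met_ge0 Md x y.
        have := Met_ge0 Md y z.
        by rewrite /Num.min; do 3 case: ifP => ?; lra.
      apply: hle => n; apply: le_trans (lerD (eh x y) (eh y z)).
      apply: le_trans (lerD (leh x y n) (leh y z n)); exact: ler_distD.
  - move=> p c c0; have [t t0 tP] := uP p.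
    (* The tents from [N] on vanish on the ball of radius [t / 2] at [p]; the finitely many others
       are Lipschitz. *)
    have [N NP] : exists N, forall n, (N <= n)%N ->
        r n <= t / 2 /\ t <= d (u n) p.
      have [N NP] : exists N, forall n, (N <= n)%N -> t <= d (u n) p.
        have [[n0 pn0]|nn0] := pselect (exists n, d p (u n) < t).
          exists n0.+1 => n n0n; rewrite leNgt; apply/negP; rewrite (Met_sym Md).
          by move=> /(tP _ _ pn0) n0E; move: n0n; rewrite n0E ltnn.
        exists 0%N => n _; rewrite leNgt; apply/negP; rewrite (Met_sym Md) => pn.
        by apply: nn0; exists n.
      exists (maxn N (Num.truncn (t / 2)^-1)) => n; rewrite geq_max => /andP[Nn].
      rewrite truncn_le_nat => tn; split; last exact: NP.
      apply: (@le_trans _ _ n.+1%:R^-1); first by rewrite ge_min lexx orbT.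
      rewrite -[leRHS]invrK lef_pV2 ?posrE ?invr_gt0 ?ltr0n ?divr_gt0//.
      exact: ltW.
    have [l l0 lr] := seq_pos_lbound (iota 0 N) r0.
    exists (Num.min (t / 2) (Num.min (c / 2 * l) (c / 2))).
      by rewrite !lt_min !mulr_gt0 ?divr_gt0.
    move=> y; rewrite !lt_min => /and3P[yt yl yc].
    apply: (@le_lt_trans _ _ (c / 2)); last by lra.
    rewrite ee ge_min (ltW yc) /=; apply: hle => n.
    have [Nn|nN] := leqP N n.
      have [rt tp] := NP n Nn.
      rewrite !f_far ?subrr ?normr0; first by lra.
        have := Met_triangle Md (u n) y p; rewrite (Met_sym Md y p); lra.
      by lra.
    apply: le_trans (flip n p y) _; rewrite ler_pdivrMr//.
    apply: le_trans (ltW yl) _; rewrite ler_pM2l; last by lra.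
    by apply: lr; rewrite mem_iota.
  - move=> x c c0; exists (Num.min c 1); first by rewrite lt_min c0 ltr01.
    move=> y /(le_lt_trans (em x y)); rewrite lt_min !gt_min ltxx orbF.
    by move=> /andP[/orP[dc _ //|c1] d1]; exact: lt_trans c1.
move=> m n mn; apply/eqP; rewrite eq_le ee ge_min lexx orbT /=.
apply/andP; split.
  apply: hle => k; rewrite ler_distl.
  have := f0 k (u m); have := f1 k (u m).
  have := f0 k (u n); have := f1 k (u n); lra.
apply: le_trans (eh _ _); apply: le_trans (leh _ _ m).
rewrite {1}/f (Met_refl Md) mul0r subr0 f_far; last first.
  rewrite ge_min; apply/orP; left; rewrite leNgt; apply/negP => /(tauP m).2.
  by move=> nm; apply: mn.
by rewrite subr0 max_r// normr1.
Qed.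

Lemma Met_dense_approx (R : realType) (X : topologicalType)
    (A : set (X -> X -> R)) d eps : Met_dense R X A -> Met R X d -> 0 < eps ->
  exists2 e, A e & forall x y, `|d x y - e x y| < eps.
Proof.
move=> [_ dA] Md eps0.
(* The uniform bound [c] strictly below [eps] leaves the room that makes [U] open. *)
pose U := [set e | Met R X e /\
  exists2 c, c < eps & forall x y, `|d x y - e x y| <= c].
have oU : Met_open R X U.
  split; first by move=> e [].
  move=> e [Me [c ce cP]]; exists ((eps - c) / 2); first by lra.
  move=> e' [Me' ee']; split => //; exists (c + (eps - c) / 2); first by lra.
  move=> x y; apply: le_trans (lerD (cP x y) (ltW (DX_ltP x y ee'))).
  exact: ler_distD.
have U0 : U !=set0.
  exists d; split => //; exists (eps / 2); first by lra.
  by move=> x y; rewrite subrr normr0; lra.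
have [e [[_ [c ce cP]] Ae]] := dA U oU U0.
by exists e => // x y; exact: le_lt_trans (cP x y) ce.
Qed.

(** A metric within [1 / 2] of the equilateral one has distances between [1 / 2] and [3 / 2] on
    distinct terms of [u]; doubling would bound the number of these terms. *)
Lemma dense_DoublingMet_compact (R : realType) (X : topologicalType)
    (d : X -> X -> R) : Met R X d -> Met_dense R X (DoublingMet R X) ->
  compact [set: X].
Proof.
move=> Md dense; apply: contrapT => ncX.
have [e [u [Me eu]]] := noncompact_equilateral_metric Md ncX.
have half0 : 0 < 1 / 2 :> R by lra.
have [e' [Me' [beta [C [b0 C1 dbl]]]] ee'] := Met_dense_approx dense Me half0.
(* Here [.+1] would already exceed the bound; [.+2] also provides the two points that doubling asks
   for. *)
pose K := (Num.truncn (C * powR ((3 / 2) / (1 / 2)) beta)).+2.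
have uinj : injective u.
  move=> m n umn; apply: contrapT => /eu; rewrite umn (Met_refl Me) => /eqP.
  by rewrite eq_sym oner_eq0.
have e1 m n : e (u m) (u n) <= 1.
  by have [->|/eqP /eu->//] := eqVneq m n; rewrite (Met_refl Me).
suff : K%:R <= C * powR ((3 / 2) / (1 / 2)) beta.
  by apply/negP; rewrite -ltNge; apply: lt_trans (truncnS_gt _) _; rewrite ltr_nat.
pose s := [seq u i | i <- iota 0 K].
have -> : K = size s by rewrite /s size_map size_iota.
apply: (doubling_card Me') => //.
- by rewrite map_inj_uniq ?iota_uniq.
- move=> _ _ /mapP[m _ ->] /mapP[n _ ->].
  by have := ee' (u m) (u n); have := e1 m n; rewrite ltr_distl; lra.
- move=> _ _ /mapP[m _ ->] /mapP[n _ ->] mn.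
  have := ee' (u m) (u n); rewrite eu ?ltr_distl; first by lra.
  by move=> mnE; apply: mn; rewrite mnE.
Qed.

(** * Embedding finite-dimensional compacta *)

(* The integers [floor (a t / eta) * k + rank t] are distinct modulo [k]. *)
Lemma spaced_values (R : realType) (T : finType) (a : T -> R) (eta : R) :
  0 < eta -> exists (p : T -> R) (s : R), [/\ 0 < s,
    (forall t, `|a t - p t| <= eta) &
    (forall t u, t <> u -> s <= `|p t - p u|)].
Proof.
move=> eta0; pose k := #|T|.+1.
have k0 : 0 < k%:R :> R by rewrite ltr0n.
pose N t : int := Num.floor (a t / eta) * k%:Z + (enum_rank t)%:Z.
have Ninj t u : N t = N u -> t = u.
  move=> /(congr1 (fun z => (z %% k%:Z)%Z)); rewrite !modzMDl.
  have rk (v : T) : ((enum_rank v)%:Z %% k%:Z)%Z = (enum_rank v)%:Z.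
    by apply: modz_small; rewrite /= ltz_nat /k ltnS ltnW.
  by rewrite !rk => -[/val_inj /enum_rank_inj].
(* The floor gives a multiple of [eta] at most [eta] below [a t], and the rank adds at most [eta];
   distinct integers are scaled to values at least [eta / k] apart. *)
exists (fun t => eta / k%:R * (N t)%:~R), (eta / k%:R); split.
- exact: divr_gt0.
- move=> t; have /andP[qa aq] := floor_itv (a t / eta).
  have rk : (enum_rank t)%:R <= k%:R :> R by rewrite ler_nat /k ltnW// ltnS ltnW.
  have rk0 : 0 <= (enum_rank t)%:R :> R by rewrite ler0n.
  rewrite ler_pdivlMr// in qa; rewrite ltr_pdivrMr// intrD in aq.
  have -> : eta / k%:R * (N t)%:~R =
      (Num.floor (a t / eta))%:~R * eta + eta * ((enum_rank t)%:R / k%:R).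
    by rewrite /N intrD intrM -!pmulrn; field; rewrite gt_eqF.
  have rk1 : (enum_rank t)%:R / k%:R <= 1 :> R by rewrite ler_pdivrMr// mul1r.
  have rk2 : 0 <= (enum_rank t)%:R / k%:R :> R by rewrite divr_ge0// ltW.
  rewrite ler_distl; nra.
- move=> t u tu; rewrite -mulrBr normrM gtr0_norm ?divr_gt0//.
  have : 1 <= `|N t - N u|.
    by rewrite -gtz0_ge1 normr_gt0 subr_eq0; apply/eqP => /Ninj.
  by rewrite -(ler_int R) intr_norm intrB => ?; rewrite ler_peMr// ltW// divr_gt0.
Qed.

(* The distance to the complement of [V], truncated at [1]. *)
Lemma depth_function (R : realType) (X : topologicalType) (d : X -> X -> R)
    (V : set X) : Met R X d -> exists phi : X -> R, [/\
    (forall x y, `|phi x - phi y| <= d x y),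
    (forall x, 0 < phi x -> V x) &
    (forall x l, l <= 1 -> [set y | d x y < l] `<=` V -> l <= phi x)].
Proof.
(* The element [1] keeps the set nonempty when [V] is the whole space. *)
move=> Md; pose E x := [set r | r = 1 \/ exists2 y, ~ V y & r = d x y].
have E1 x : E x 1 by left.
have Elb x : has_lbound (E x).
  by exists 0 => _ [->|[y _ ->]]; [exact: ler01|exact: Met_ge0].
have le1 x y : inf (E x) <= inf (E y) + d x y.
  rewrite -lerBlDr; apply: lb_le_inf; first by exists 1.
  move=> _ [->|[z Vz ->]].
    by have := ge_inf (Elb x) (E1 x); have := Met_ge0 Md x y; lra.
  have Exz : E x (d x z) by right; exists z.
  by have := ge_inf (Elb x) Exz; have := Met_triangle Md x y z; lra.
exists (fun x => inf (E x)); split.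
- move=> x y; have := le1 x y; have := le1 y x; rewrite (Met_sym Md y x).
  by rewrite ler_distl; lra.
- move=> x x0; apply: contrapT => Vx.
  have /(ge_inf (Elb x)) : E x 0 by right; exists x; rewrite ?(Met_refl Md).
  by lra.
- move=> x l l1 lV; apply: lb_le_inf; first by exists 1.
  move=> _ [->//|[y Vy ->]]; rewrite leNgt; apply/negP => xy.
  exact/Vy/lV.
Qed.

Definition clamp (R : realType) (t : R) := Num.min (Num.max t 0) 1.

Lemma clamp_ge0 (R : realType) (t : R) : 0 <= clamp t.
Proof. by rewrite /clamp le_min le_max lexx orbT ler01. Qed.

Lemma clamp_le1 (R : realType) (t : R) : clamp t <= 1.
Proof. by rewrite /clamp ge_min lexx orbT. Qed.

Lemma clamp_eq0 (R : realType) (t : R) : t <= 0 -> clamp t = 0.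
Proof. by move=> t0; rewrite /clamp max_r// min_l. Qed.

Lemma clamp_eq1 (R : realType) (t : R) : 1 <= t -> clamp t = 1.
Proof. by move=> t1; rewrite /clamp max_l ?min_r//; apply: le_trans t1. Qed.

Lemma clamp_id (R : realType) (t : R) : 0 <= t -> t <= 1 -> clamp t = t.
Proof. by move=> t0 t1; rewrite /clamp max_l// min_l. Qed.

Lemma clamp_lip (R : realType) (s t : R) : `|clamp s - clamp t| <= `|s - t|.
Proof.
wlog st : s t / s <= t.
  by move=> h; have [/h//|/ltW/h] := leP s t; rewrite distrC (distrC t).
have [s0|/ltW s0] := leP s 0; have [s1|/ltW s1] := leP s 1;
have [t0|/ltW t0] := leP t 0; have [t1|/ltW t1] := leP t 1;
  rewrite ?(clamp_eq0 s0) ?(clamp_eq0 t0) ?(clamp_eq1 s1) ?(clamp_eq1 t1)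
    ?(clamp_id s0 s1) ?(clamp_id t0 t1);
  rewrite [leRHS]ler0_norm ?ler_distl; lra.
Qed.

Lemma common_radius (R : realType) (X : topologicalType) (d : X -> X -> R)
    (I : finType) (f : I -> X -> R) (x : X) (eta : R) : Met R X d ->
  (forall i, continuous (f i)) -> 0 < eta ->
  exists2 r, 0 < r & forall i y, d x y < r -> `|f i x - f i y| < eta.
Proof.
move=> Md fc eta0.
have /choice[r rP] : forall i, exists r, 0 < r /\
    forall y, d x y < r -> `|f i x - f i y| < eta.
  move=> i; have /cvgrPdist_lt /(_ _ eta0) /(Met_nbhsP Md)[r r0 rP] := fc i x.
  by exists r; split => // y /rP.
have [l l0 lr] := seq_pos_lbound (enum I) (fun i => (rP i).1).
exists l => // i y xy; apply: (rP i).2; apply: lt_le_trans xy _.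
by apply: lr; rewrite mem_enum.
Qed.

(** * Kolmogorov colourings by thresholds *)

Section Colouring.
Variables (R : realType) (X : topologicalType) (m M n : nat).
Variables (phi : 'I_m -> X -> R) (lam : R).
Hypothesis lam0 : 0 < lam.
Hypothesis phi_ge : forall x, exists j, lam <= phi j x.
Hypothesis phi_mult : forall x, (#|[set j | (0 < phi j x)%R]%SET| <= n.+1)%N.
Hypothesis nM : (n.+1 + n.+1 < M)%N.

(** The [M] thresholds are the interior points dividing [[0, lam]] into [M + 1] parts of length
    [gap]. *)
Let gap : R := lam / M.+1%:R.
Let theta (c : 'I_M) : R := c.+1%:R * gap.
Let sgn (c : 'I_M) (T : {set 'I_m}) j x : R :=
  if j \in T then phi j x - theta c else theta c - phi j x.

Definition colour_set (c : 'I_M) (x : X) : {set 'I_m} :=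
  [set j | theta c < phi j x]%SET.

(** Equals [1] when every [phi j x] is at least [gap / 4] away from the threshold on the side
    prescribed by [T], and [0] when one is on the wrong side. Hence only [T = colour_set c x] can
    contribute at [x]. *)
Definition colour_bump (c : 'I_M) (T : {set 'I_m}) (x : X) : R :=
  \prod_j clamp (sgn c T j x / (gap / 4)).

Let gap0 : 0 < gap. Proof. by rewrite divr_gt0// ltr0n. Qed.

Let lamE : lam = M%:R * gap + gap.
Proof. by rewrite -{2}[gap]mul1r -mulrDl natr1 mulrC mulfVK// pnatr_eq0. Qed.

Let theta_ge c : gap <= theta c.
Proof. by apply: ler_peMl; [exact: ltW|rewrite ler1n]. Qed.

Let theta_le c : theta c + gap <= lam.
Proof. by rewrite lamE lerD2r ler_pM2r// ler_nat. Qed.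

Lemma colour_set_neq0 c x : exists j, j \in colour_set c x.
Proof.
have [j lj] := phi_ge x; exists j; rewrite finset.inE.
by have := theta_le c; have := gap0; lra.
Qed.

Lemma colour_set_gt0 c x j : j \in colour_set c x -> 0 < phi j x.
Proof.
by rewrite finset.inE; have := theta_ge c; have := gap0; lra.
Qed.

Lemma colour_bump_ge0 c T x : 0 <= colour_bump c T x.
Proof. by apply: prodr_ge0 => j _; exact: clamp_ge0. Qed.

Lemma colour_bump_le1 c T x : colour_bump c T x <= 1.
Proof.
apply: (@le_trans _ _ (\prod_(j < m) 1)); last by rewrite big1.
by apply: ler_prod => j _; rewrite clamp_ge0 clamp_le1.
Qed.

Lemma colour_bump_eq0 c T x : T <> colour_set c x -> colour_bump c T x = 0.
Proof.
move=> TS; have [j jT] : exists j, (j \in T) != (j \in colour_set c x).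
  apply: contrapT => /forallNP h; apply: TS; apply/setP => j.
  by apply/eqP; apply: contrapT => /negP /h.
rewrite /colour_bump (bigD1 j)//= clamp_eq0 ?mul0r//.
rewrite pmulr_lle0 ?invr_gt0 ?divr_gt0// /sgn.
by move: jT; rewrite finset.inE; case: (j \in T) => /=; case: ltP => //; lra.
Qed.

(* A value of some [phi j] spoils at most one threshold, and only [n + 1] of
   these values are nonzero, so more than half of the colours are good at each
   point. *)
Lemma common_colour x y : exists c,
  colour_bump c (colour_set c x) x = 1 /\ colour_bump c (colour_set c y) y = 1.
Proof.
have M0 : (0 < M)%N by apply: leq_ltn_trans nM.
pose hit (c : 'I_M) z j := `|phi j z - theta c| < gap / 4.
pose bad z : {set 'I_M} := [set c | [exists j, hit c z j]]%SET.
have hit_inj z j c c' : hit c z j -> hit c' z j -> c = c'.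
  rewrite /hit !ltr_distl => hc hc'.
  suff cc (u v : 'I_M) : (u < v)%N -> gap <= theta v - theta u.
    apply/val_inj; case: (ltngtP c c') => [/cc h|/cc h|//]; exfalso;
      move: h; have := gap0; lra.
  move=> uv; rewrite -mulrBl; apply: ler_peMl; first exact: ltW.
  by rewrite lerBrDr addrC natr1 ler_nat ltnS.
have bad_card z : (#|bad z| <= n.+1)%N.
  (* Each index is sent to the one threshold its value hits; [Ordinal M0] is a dummy for indices
     that hit none. A hit forces [phi j z] to be positive, so [phi_mult] bounds the image. *)
  pose col j := odflt (Ordinal M0) [pick c | hit c z j].
  apply: leq_trans (phi_mult z).
  apply: leq_trans (leq_imset_card col _); apply: subset_leq_card.
  apply/fintype.subsetP => c; rewrite finset.inE => /existsP[j hj].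
  apply/imsetP; exists j.
    move: hj; rewrite finset.inE /hit ltr_distl.
    by have := theta_ge c; have := gap0; lra.
  by rewrite /col; case: pickP => [c' /(hit_inj _ _ _ _ hj)//|/(_ c)]; rewrite hj.
have good c z : c \notin bad z -> colour_bump c (colour_set c z) z = 1.
  rewrite finset.inE negb_exists => /forallP h.
  apply: big1 => j _; apply: clamp_eq1; have := h j.
  rewrite /hit -leNgt ler_pdivlMr ?divr_gt0// mul1r /sgn finset.inE.
  by case: ltP => ?; rewrite ler_normr => /orP[]; have := gap0; lra.
have : (#|bad x :|: bad y| < #|'I_M|)%N.
  rewrite card_ord; apply: leq_ltn_trans nM.
  apply: leq_trans (leq_card_setU _ _) _; exact: leq_add.
move=> ltM; have [c] : exists c, c \notin bad x :|: bad y.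
  apply/existsP; rewrite -negb_forall; apply/negP => /forallP h.
  have : (#|'I_M| <= #|bad x :|: bad y|)%N.
    by apply: subset_leq_card; apply/fintype.subsetP => c _; exact: h.
  by rewrite leqNgt ltM.
by rewrite finset.in_setU negb_or => /andP[cx cy]; exists c; split; exact: good.
Qed.

Lemma colour_bump_continuous (d : X -> X -> R) c T : Met R X d ->
  (forall j x y, `|phi j x - phi j y| <= d x y) -> continuous (colour_bump c T).
Proof.
move=> Md lip x.
rewrite /colour_bump; apply: cvg_big => [|j _]; first exact: mul_continuous.
suff : continuous (fun x => clamp (sgn c T j x / (gap / 4))) by exact.
have L0 : 0 < (gap / 4)^-1 by rewrite invr_gt0 divr_gt0.
apply: (Met_lip_continuous Md L0) => y z; apply: le_trans (clamp_lip _ _) _.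
rewrite -mulrBl normrM mulrC (gtr0_norm L0) ler_pM2l//.
rewrite /sgn; case: ifP => _; last rewrite distrC; rewrite !opprB.
all: by apply: le_trans (lip j y z); rewrite le_eqVlt; apply/orP; left;
  apply/eqP; congr `|_|; lra.
Qed.

End Colouring.

(** Where the colour set is constant, [f] is pulled toward a nearby constant, fully so at good
    points, and all these constants are mutually separated. Two distant points have a common good
    colour and different colour sets, hence take different constants. *)
Lemma separating_perturbation (R : realType) (X : topologicalType)
    (d : X -> X -> R) (n M : nat) (f : 'I_M -> X -> R) (eta eps : R) :
  Met R X d -> compact [set: X] -> covdim_le X n -> (n.+1 + n.+1 < M)%N ->
  (forall c, continuous (f c)) -> 0 < eta -> 0 < eps ->
  exists g : 'I_M -> X -> R, [/\ (forall c, continuous (g c)),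
    (forall c x, `|f c x - g c x| <= eta) &
    exists2 s, 0 < s &
      forall x y, eps <= d x y -> exists c, s <= `|g c x - g c y|].
Proof.
move=> Md cX dimX nM fc eta0 eps0.
have /choice[r rP] : forall x, exists r, [/\ 0 < r, r <= eps / 2 &
    forall c y, d x y < r -> `|f c x - f c y| < eta / 4].
  move=> x; have e4 : 0 < eta / 4 by lra.
  have [r r0 rP] := common_radius x Md fc e4.
  exists (Num.min r (eps / 2)); split.
  - by rewrite lt_min r0; lra.
  - by rewrite ge_min lexx orbT.
  - by move=> c y; rewrite lt_min => /andP[/rP].
have [s sP] := compact_gauge Md cX (fun x => let: And3 h _ _ := rP x in h).
pose ctr := tnth (in_tuple s).
have [||m [V [oV cV VU Vn]]] :=
  dimX (size s) (fun i => [set y | d (ctr i) y < r (ctr i)]).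
- by move=> i; exact: Met_ball_open.
- apply/seteqP; split => // y _; have [x xs xy] := sP y.
  have /tnthP[i xi] : x \in in_tuple s by [].
  by exists i => //=; rewrite /ctr -xi.
have Vsmall j x y : V j x -> V j y ->
    d x y < eps /\ forall c, `|f c x - f c y| <= eta / 2.
  move=> Vx Vy; have [i Vi] := VU j.
  have [_ re rf] := rP (ctr i); move: (Vi _ Vx) (Vi _ Vy) => /= ix iy; split.
    by have := Met_triangle Md x (ctr i) y; rewrite (Met_sym Md x (ctr i)); lra.
  move=> c; have := rf c x ix; have := rf c y iy.
  by rewrite !ltr_distl ler_distl; lra.
have [l l0 lV] := lebesgue_number Md cX oV cV.
have /choice[phi phiP] := fun j => depth_function (V j) Md.
have lip j x y : `|phi j x - phi j y| <= d x y by case: (phiP j).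
have phiV j x : 0 < phi j x -> V j x by case: (phiP j) => _ + _; apply.
pose lam := Num.min l 1.
have lam0 : 0 < lam by rewrite lt_min l0 ltr01.
have phi_ge x : exists j, lam <= phi j x.
  have [j xV] := lV x; exists j; case: (phiP j) => _ _; apply.
    by rewrite ge_min lexx orbT.
  by apply: subset_trans xV => y /=; rewrite lt_min => /andP[].
have phi_mult x : (#|[set j | (0 < phi j x)%R]%SET| <= n.+1)%N.
  apply: leq_trans (Vn x); rewrite card_mkset; apply: subset_leq_card.
  apply/fintype.subsetP => j; rewrite !finset.inE => /phiV Vx.
  exact/asboolP.
pose S := @colour_set R X m M phi lam.
pose chi := @colour_bump R X m M phi lam.
(* A nonempty piece lies in a single [V j], where [f] varies by at most [eta / 2]; [0] is a dummy
   for empty pieces. *)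
have /choice[a aP] : forall p : 'I_M * {set 'I_m}, exists a, forall x,
    S p.1 x = p.2 -> `|f p.1 x - a| <= eta / 2.
  move=> [c T] /=; have [[z zT]|nz] := pselect (exists z, S c z = T).
    exists (f c z) => x xT; have [j jS] := colour_set_neq0 lam0 phi_ge c x.
    have Vx : V j x by apply: phiV; exact: (colour_set_gt0 lam0 jS).
    have Vz : V j z.
      by apply: phiV; apply: (colour_set_gt0 lam0 (c := c)); rewrite -/S zT -xT.
    by have [_ ->] := Vsmall j x z Vx Vz.
  by exists 0 => x xT; case: nz; exists x.
have eta2 : 0 < eta / 2 by lra.
have [p [sg [sg0 pa psep]]] := spaced_values a eta2.
pose g c x := f c x + \sum_T chi c T x * (p (c, T) - f c x).
have gE c x : g c x = f c x + chi c (S c x) x * (p (c, S c x) - f c x).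
  rewrite /g (bigD1 (S c x))//= big1 ?addr0// => T TS.
  by rewrite /chi colour_bump_eq0 ?mul0r//; apply/eqP.
exists g; split.
- move=> c x; apply: cvgD; first exact: fc.
  apply: cvg_big => [|T _]; first exact: add_continuous.
  apply: cvgM; first exact: (colour_bump_continuous lam0 Md lip).
  by apply: cvgB; [exact: cvg_cst|exact: fc].
- move=> c x; rewrite gE opprD addrA subrr add0r normrN normrM.
  have chi0 := colour_bump_ge0 phi lam c (S c x) x.
  have chi1 := colour_bump_le1 phi lam c (S c x) x.
  rewrite ger0_norm//; apply: (@le_trans _ _ `|p (c, S c x) - f c x|).
    by rewrite ler_piMl.
  have := aP (c, S c x) x erefl; have := pa (c, S c x).
  by rewrite /= !ler_distl; lra.
- exists sg => // x y xy.
  have [c [cx cy]] := common_colour lam0 phi_mult nM x y.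
  exists c; rewrite !gE /chi cx cy !mul1r !subrKC; apply: psep => -[SE].
  have [j jS] := colour_set_neq0 lam0 phi_ge c x.
  have Vx : V j x by apply: phiV; exact: (colour_set_gt0 lam0 jS).
  have Vy : V j y.
    by apply: phiV; apply: (colour_set_gt0 lam0 (c := c)); rewrite -/S -SE.
  by have [] := Vsmall j x y Vx Vy; rewrite ltNge xy.
Qed.

(* A limit of successive perturbations: the [k]-th one separates points at
   distance at least [1/(k+1)] by a margin that the later ones preserve. *)
Lemma separating_functions (R : realType) (X : topologicalType)
    (d : X -> X -> R) (n M : nat) (eta : R) :
  Met R X d -> compact [set: X] -> covdim_le X n -> (n.+1 + n.+1 < M)%N ->
  0 < eta ->
  exists F : 'I_M -> X -> R, [/\ (forall c, continuous (F c)),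
    (forall c x, `|F c x| <= eta) &
    forall eps, 0 < eps -> exists2 s, 0 < s &
      forall x y, eps <= d x y -> exists c, s <= `|F c x - F c y|].
Proof.
move=> Md cX dimX nM eta0.
pose valid (st : ('I_M -> X -> R) * R) :=
  (forall c, continuous (st.1 c)) /\ 0 < st.2.
(* The second component is a tolerance: the limit stays within [st'.2] of [st'.1], so at least
   [st'.2] is left of the margin [3 * st'.2]. *)
pose step k (st st' : ('I_M -> X -> R) * R) := [/\ valid st',
  (forall c x, `|st.1 c x - st'.1 c x| <= st.2 / 2), st'.2 <= st.2 / 2 &
  forall x y, k.+1%:R^-1 <= d x y ->
    exists c, 3 * st'.2 <= `|st'.1 c x - st'.1 c y| ].
have /choice[nx nxP] : forall kst : nat * (('I_M -> X -> R) * R), exists st',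
    valid kst.2 -> step kst.1 kst.2 st'.
  move=> [k [f gam]] /=; have [[/= fc gam0]|] := pselect (valid (f, gam)); last first.
    (* An invalid state gets a dummy successor, as choice needs a total function. *)
    by exists (f, gam).
  have gam2 : 0 < gam / 2 by lra.
  have k0 : 0 < k.+1%:R^-1 :> R by rewrite invr_gt0 ltr0n.
  have [g [gc fg [s s0 sP]]] := separating_perturbation Md cX dimX nM fc gam2 k0.
  exists (g, Num.min (gam / 2) (s / 3)) => _.
  have m0 : 0 < Num.min (gam / 2) (s / 3) by rewrite lt_min gam2; lra.
  split => //=; first by rewrite ge_min lexx.
  move=> x y /sP[c cs]; exists c; apply: le_trans cs.
  have : Num.min (gam / 2) (s / 3) <= s / 3 by rewrite ge_min lexx orbT.
  lra.
pose st := fix st k := if k is k'.+1 then nx (k', st k')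
  else ((fun _ _ => 0) : 'I_M -> X -> R, eta).
have vst k : valid (st k).
  elim: k => [|k IH]; first by split => //= c x; exact: cvg_cst.
  by have [] := nxP (k, st k) IH.
have stP k : step k (st k) (st k.+1) by exact: (nxP (k, st k) (vst k)).
pose f k := (st k).1; pose gam k := (st k).2.
have gam0 k : 0 < gam k by case: (vst k).
(* The intervals of radius [gam k] about [f k c x] are nested, because the move and the new radius
   are each at most half the old radius. The limit is the supremum of the left ends. *)
have lo k i c x : f k c x - gam k <= f (k + i)%N c x - gam (k + i)%N /\
    f (k + i)%N c x + gam (k + i)%N <= f k c x + gam k.
  elim: i => [|i [IH1 IH2]]; first by rewrite addn0.
  rewrite addnS; have [_ /(_ c x) h1 h2 _] := stP (k + i)%N.
  by move: h1 h2 IH1 IH2; rewrite -/(f _) -/(f _) -/(gam _) -/(gam _) ler_distl; lra.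
have nested j k c x : f j c x - gam j <= f k c x + gam k.
  have [jk|/ltnW kj] := leqP j k.
    have [h _] := lo j (k - j)%N c x; rewrite subnKC// in h.
    by have := gam0 k; lra.
  have [_ h] := lo k (j - k)%N c x; rewrite subnKC// in h.
  by have := gam0 j; lra.
pose F c x := sup (range (fun k => f k c x - gam k)).
have Ff c x k : `|F c x - f k c x| <= gam k.
  have h1 : f k c x - gam k <= F c x.
    apply: ub_le_sup; last by exists k.
    by exists (f 0%N c x + gam 0%N) => _ [j _ <-]; exact: nested.
  have h2 : F c x <= f k c x + gam k.
    apply: ge_sup; first by exists (f 0%N c x - gam 0%N), 0%N.
    by move=> _ [j _ <-]; exact: nested.
  by rewrite ler_distl h2 andbT; lra.
have gamE k : gam k <= eta * k.+1%:R^-1.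
  elim: k => [|k IH]; first by rewrite invr1 mulr1.
  have [_ _ h _] := stP k; apply: le_trans h _; rewrite -/(gam k).
  apply: (@le_trans _ _ (eta * k.+1%:R^-1 / 2)); first by rewrite ler_pM2r ?invr_gt0.
  rewrite -mulrA ler_pM2l// -invfM lef_pV2 ?posrE ?mulr_gt0 ?ltr0n//.
  by rewrite -natrM ler_nat muln2 -addnn addSn ltnS leq_addl.
have inv_small e : 0 < e -> exists k, k.+1%:R^-1 < e :> R.
  move=> e0; exists (Num.truncn e^-1).
  by rewrite -[ltRHS]invrK ltf_pV2 ?posrE ?invr_gt0 ?ltr0n ?truncnS_gt.
exists F; split.
- move=> c x; apply/cvgrPdist_lt => e e0.
  have [|k ke] := inv_small (e / (3 * eta)); first by rewrite divr_gt0 ?mulr_gt0.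
  have ge : gam k < e / 3.
    apply: le_lt_trans (gamE k) _; rewrite mulrC -ltr_pdivlMr//.
    by rewrite -mulrA -invfM.
  have e3 : 0 < e / 3 by lra.
  have [/(_ c x) /cvgrPdist_lt /(_ _ e3) fk _] := vst k.
  near=> y; have := Ff c x k; have := Ff c y k.
  have : `|f k c x - f k c y| < e / 3 by near: y.
  by rewrite !ltr_distl !ler_distl; lra.
- by move=> c x; have := Ff c x 0%N; rewrite subr0.
- move=> eps /inv_small[k ke]; exists (gam k.+1) => // x y xy.
  have [_ _ _ /(_ x y (le_trans (ltW ke) xy))[c]] := stP k.
  rewrite -/(f k.+1) -/(gam k.+1) => cs; exists c.
  have := Ff c x k.+1; have := Ff c y k.+1; move: cs.
  by rewrite !ler_distl !ler_normr => /orP[] ? ? ?; apply/orP; [left|right]; lra.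
Unshelve. all: by end_near. Qed.

(** * Metrics pulled back from finite-dimensional sup-norms *)

Section SupMetric.
Variables (R : realType) (X : topologicalType) (I : finType).
Variable F : I -> X -> R.

Definition sup_metric (x y : X) : R := \big[Order.max/0]_i `|F i x - F i y|.

Lemma le_sup_metric i x y : `|F i x - F i y| <= sup_metric x y.
Proof. exact: (le_bigmax _ (fun i => `|F i x - F i y|)). Qed.

Lemma sup_metric_le x y r : 0 <= r -> (forall i, `|F i x - F i y| <= r) ->
  sup_metric x y <= r.
Proof. by move=> r0 h; apply: bigmax_le. Qed.

Lemma sup_metric_lt x y r : 0 < r -> (forall i, `|F i x - F i y| < r) ->
  sup_metric x y < r.
Proof. by move=> r0 h; apply: bigmax_lt. Qed.

Lemma sup_metric_ge0 x y : 0 <= sup_metric x y.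
Proof. exact: bigmax_ge_id. Qed.

Lemma sup_metric_Met (d : X -> X -> R) : Met R X d ->
  (forall i, continuous (F i)) ->
  (forall eps, 0 < eps -> exists2 s, 0 < s &
    forall x y, eps <= d x y -> exists i, s <= `|F i x - F i y|) ->
  Met R X sup_metric.
Proof.
move=> Md Fc sep; apply: (Met_equiv Md).
- split.
  + exact: sup_metric_ge0.
  + move=> x y; split=> [exy|<-].
      apply: contrapT => /(Met_gt0 Md) /sep[s s0 /(_ x y (lexx _))[i si]].
      by have := le_sup_metric i x y; rewrite exy; lra.
    apply/eqP; rewrite eq_le sup_metric_ge0 andbT; apply: sup_metric_le => // i.
    by rewrite subrr normr0.
  + by move=> x y; apply: eq_bigr => i _; rewrite distrC.
  + move=> x y z; apply: sup_metric_le; first by rewrite addr_ge0// sup_metric_ge0.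
    move=> i; apply: le_trans (lerD (le_sup_metric i x y) (le_sup_metric i y z)).
    exact: ler_distD.
- move=> x r r0; have [t t0 tP] := common_radius x Md Fc r0.
  by exists t => // y xy; apply: sup_metric_lt => // i; exact: tP.
- move=> x r /sep[s s0 sP]; exists s => // y xy; rewrite ltNge; apply/negP.
  by move=> /sP[i]; have := le_sup_metric i x y; lra.
Qed.

(* Points of [A] at mutual distance at least [a] lie in distinct cells of a
   cubical grid of mesh [a], at most [2 D / a + 1] of which meet [A] in each
   direction. *)
Lemma sup_metric_doubling : Met R X sup_metric -> doubling R X sup_metric.
Proof.
(* Each direction meets at most [2 (D / a) + 1 <= 3 (D / a)] cells, whence [3 ^ #|I|]. The exponent
   is positive even for empty [I]. *)
move=> Me; exists #|I|.+1%:R, (3 ^+ #|I|); split=> //.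
  by rewrite exprn_ege1// ler1n.
move=> A fA A2; have AA := fset_set_two fA A2.
have t1 := diam_sepr_ge1 Me fA AA; have a0 := sepr_gt0 Me fA AA.
have [s [us <- sA]] := card_fset_setP fA.
set D := diam _ _ _ _ in t1 *; set a := sepr _ _ _ _ in t1 a0 *.
have [x0 [_ [Ax0 _ _]]] := AA.
(* The shift by [D] makes the coordinates nonnegative on [A], as truncation to naturals requires. *)
pose w i x := (F i x - F i x0 + D) / a.
have wP i x : x \in s -> 0 <= w i x <= 2 * (D / a).
  move=> /sA Ax; have := le_diam sup_metric fA Ax Ax0.
  move=> /(le_trans (le_sup_metric i x x0)); rewrite -/D ler_norml => /andP[h1 h2].
  apply/andP; split; first by apply: divr_ge0; [lra|exact: ltW].
  by rewrite mulrA ler_pM2r ?invr_gt0//; lra.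
pose N := Num.truncn (2 * (D / a)).
pose q x : {ffun I -> 'I_N.+1} := [ffun i => inord (Num.truncn (w i x))].
have qinj : {in s &, injective q}.
  move=> x y xs ys /ffunP qxy; apply: contrapT => xy.
  have := sepr_le Me ((sA x).1 xs) ((sA y).1 ys) xy; rewrite -/a leNgt.
  apply/negP/negPn; apply: sup_metric_lt => // i.
  have /andP[wx0 wx1] := wP i x xs; have /andP[wy0 wy1] := wP i y ys.
  have := qxy i; rewrite !ffunE => /(congr1 val); rewrite /= !inordK ?ltnS ?le_truncn//.
  move=> wxy; have := truncn_itv wx0; have := truncn_itv wy0; rewrite wxy -natr1.
  have -> : F i x - F i y = (w i x - w i y) * a.
    by rewrite /w; field; rewrite gt_eqF.
  rewrite normrM (gtr0_norm a0) gtr_pMl// ltr_distl; lra.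
have sN : (size s <= N.+1 ^ #|I|)%N.
  rewrite -[N.+1]card_ord -card_ffun -(size_map q).
  have /card_uniqP <- : uniq (map q s) by rewrite map_inj_in_uniq.
  exact: max_card.
rewrite powR_mulrn; last by lra.
apply: (@le_trans _ _ (N.+1%:R ^+ #|I|)); first by rewrite -natrX ler_nat.
apply: (@le_trans _ _ ((3 * (D / a)) ^+ #|I|)).
  apply: lerXn2r; rewrite ?nnegrE ?ler0n//; first by lra.
  have : 0 <= 2 * (D / a) by lra.
  by move=> /truncn_itv; rewrite -/N -natr1; lra.
by rewrite exprMn ler_pM2l ?exprn_gt0// ler_weXn2l.
Qed.

End SupMetric.

(** * Density and the equivalence *)

Lemma DoublingMet_dense (R : realType) (X : topologicalType) :
  finite_dimensional X -> compact [set: X] ->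
  Met_dense R X (DoublingMet R X).
Proof.
move=> [n dimX] cX; split; first by move=> d [].
move=> U [UM oU] [d Ud]; have Md := UM d Ud; have [eps eps0 epsU] := oU d Ud.
have e4 : 0 < eps / 4 by lra.
have [s sP] := compact_gauge Md cX (fun=> e4).
have [G [Gc Gb Gsep]] := separating_functions Md cX dimX (ltnSn _) e4.
(* Distances to an [eps / 4]-net recover [d] from below up to [eps / 2] and never exceed it; the
   [2 n + 3] functions [G c] separate points, and their differences are at most [eps / 2]. *)
pose F (i : 'I_(size s) + 'I_(n.+1 + n.+1).+1) x : R :=
  match i with inl i => d x (tnth (in_tuple s) i) | inr c => G c x end.
have Me : Met R X (sup_metric F).
  apply: (sup_metric_Met Md).
    case=> [i|c]; last exact: Gc.
    apply: (Met_lip_continuous Md ltr01) => x y; rewrite mul1r.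
    exact: Met_dist_lip.
  move=> e /Gsep[t t0 tP]; exists t => // x y /tP[c ct].
  by exists (inr c).
exists (sup_metric F); split; last by split => //; exact: sup_metric_doubling.
apply: epsU; split => //; apply: (@le_lt_trans _ _ (eps / 2)%:E); last first.
  by rewrite lte_fin; lra.
apply: DX_le => x y; rewrite ler_distlC; apply/andP; split.
  have [z zs zy] := sP y; have /tnthP[i zi] : z \in in_tuple s by [].
  have := le_sup_metric F (inl i) x y; rewrite /F -zi ler_norml.
  have := Met_triangle Md x z y; rewrite (Met_sym Md y z); lra.
apply: sup_metric_le; first by have := Met_ge0 Md x y; lra.
case=> [i|c] /=.
  by have := Met_dist_lip Md x y (tnth (in_tuple s) i); lra.
have := Gb c x; have := Gb c y; have := Met_ge0 Md x y.
by rewrite !ler_norml; lra.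
Qed.

Theorem theorem1p1 (R : realType) (X : topologicalType) :
  metrizable R X ->
  ((finite_dimensional X /\ compact [set: X]) <->
   (Met_dense R X (DoublingMet R X) /\ Met_Fsigma R X (DoublingMet R X))).
Proof.
move=> [d Md]; split=> [[fX cX]|[dense _]].
  by split; [exact: DoublingMet_dense|exact: DoublingMet_Fsigma].
have cX := dense_DoublingMet_compact Md dense.
have [e [Me dbl] _] := Met_dense_approx dense Md ltr01.
by split => //; exact: doubling_compact_finite_dimensional Me dbl cX.
Qed.
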